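(* Let $T_1,T_2$ be $2\times2$ matrices with entries in $\{0,1\}$, neither having a zero row, and let $F$ be the associated recurrence system. Then $F$ is of at least one of the following four types: zero entropy type, equal growth type, dominating type, or oscillating type.
   Context: Let $\alpha_i=T_1^{(i)}\otimes T_2^{(i)}$ ($i=1,2$), where $T_k^{(i)}$ is the $i$-th row of $T_k$ and $(v_1,v_2)\otimes(w_1,w_2)=(v_1w_1,v_1w_2,v_2w_1,v_2w_2)$; $|\alpha_i|$ is the number of ones in $\alpha_i$. The recurrence system $F$: $\gamma^{[s_j]}_{i,0}=1$ and for $n\ge1$ $$\gamma^{[s_1]}_{i,n}=\sum_{j,k=1}^2T_1(i,j)T_2(i,k)\,\gamma^{[s_1]}_{j,n-1}\gamma^{[s_2]}_{k,n-1},\qquad \gamma^{[s_2]}_{i,n}=\sum_{j=1}^2T_1(i,j)\,\gamma^{[s_1]}_{j,n-1}.$$ (This describes the numbers of admissible blocks of the $G$-vertex shift with adjacency matrices $T$ on $G=\langle s_1,s_2\mid s_2s_2=s_2\rangle$.) Types: $F$ is of zero entropy type if $|\alpha_1|=|\alpha_2|=1$; of equal growth type if $|\alpha_1|=|\alpha_2|$. The items of $\gamma^{[s_1]}_{i,n}$ are the products $\gamma^{[s_1]}_{j,n-1}\gamma^{[s_2]}_{k,n-1}$ for pairs $(j,k)$ with $T_1(i,j)T_2(i,k)=1$; the items of $\gamma^{[s_2]}_{i,n}$ are the terms $\gamma^{[s_1]}_{j,n-1}$ for $j$ with $T_1(i,j)=1$; write $\gamma^{[s_j]}_{i,n}=\sum_l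 f^{ij}_{l,n-1}$. $\gamma^{[s_j]}_{i,n}$ has a dominate item if there is an index $r$ with $f^{ij}_{r,n}\ge f^{ij}_{l,n}$ for all indices $l\ne r$ and all $n\ge1$; $F$ is of dominating type if all four of $\gamma^{[s_1]}_{1,n},\gamma^{[s_1]}_{2,n},\gamma^{[s_2]}_{1,n},\gamma^{[s_2]}_{2,n}$ have a dominate item. $F$ is of oscillating type if there are two (infinite) sequences $\{m^1_n\},\{m^2_n\}$ of positive integers with disjoint ranges whose union is $\mathbb{N}$, such that $\gamma^{[s_1]}_{1,n}\ge\gamma^{[s_1]}_{2,n}$ for $n\in\{m^1_n\}$ and $\gamma^{[s_1]}_{1,n}<\gamma^{[s_1]}_{2,n}$ for $n\in\{m^2_n\}$. *)

(* Defs.v *)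
From mathcomp Require Import all_boot all_order all_algebra.
Set Implicit Arguments. Unset Strict Implicit. Unset Printing Implicit Defensive.

Definition mat2 := 'M[nat]_2.

Definition idx1 : 'I_2 := ord0.
Definition idx2 : 'I_2 := ord_max.

Definition zero_one (T : mat2) : Prop := forall i j, T i j <= 1.
Definition no_zero_row (T : mat2) : Prop := forall i, exists j, T i j != 0.

Fixpoint gam (T1 T2 : mat2) (n : nat) : ('I_2 -> nat) * ('I_2 -> nat) :=
  match n with
  | 0 => (fun _ => 1, fun _ => 1)
  | m.+1 =>
      let g := gam T1 T2 m in
      (fun i => \sum_(j < 2) \sum_(k < 2) T1 i j * T2 i k * g.1 j * g.2 k,
       fun i => \sum_(j < 2) T1 i j * g.1 j)
  end.

Definition gamma1 (T1 T2 : mat2) (i : 'I_2) (n : nat) : nat := (gam T1 T2 n).1 i.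
Definition gamma2 (T1 T2 : mat2) (i : 'I_2) (n : nat) : nat := (gam T1 T2 n).2 i.

(* alpha_i = T1^(i) (x) T2^(i); |alpha_i| = number of ones in it,
   i.e. number of pairs (j,k) with T1(i,j) * T2(i,k) = 1. *)
Definition alpha_card (T1 T2 : mat2) (i : 'I_2) : nat :=
  #|[set jk : 'I_2 * 'I_2 | T1 i jk.1 * T2 i jk.2 == 1]|.

Definition zero_entropy_type (T1 T2 : mat2) : Prop :=
  alpha_card T1 T2 idx1 = 1 /\ alpha_card T1 T2 idx2 = 1.

Definition equal_growth_type (T1 T2 : mat2) : Prop :=
  alpha_card T1 T2 idx1 = alpha_card T1 T2 idx2.

(* Items of gamma^{[s1]}_{i,n+1}: indexed by pairs (j,k) with T1(i,j)T2(i,k)=1,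
   the item with index (j,k) at level n being gamma^{[s1]}_{j,n} gamma^{[s2]}_{k,n}. *)
Definition has_dominate_item1 (T1 T2 : mat2) (i : 'I_2) : Prop :=
  exists r : 'I_2 * 'I_2, T1 i r.1 * T2 i r.2 = 1 /\
    forall l : 'I_2 * 'I_2, l != r -> T1 i l.1 * T2 i l.2 = 1 ->
      forall n, 1 <= n ->
        gamma1 T1 T2 l.1 n * gamma2 T1 T2 l.2 n <=
        gamma1 T1 T2 r.1 n * gamma2 T1 T2 r.2 n.

(* Items of gamma^{[s2]}_{i,n+1}: indexed by j with T1(i,j)=1,
   the item with index j at level n being gamma^{[s1]}_{j,n}. *)
Definition has_dominate_item2 (T1 T2 : mat2) (i : 'I_2) : Prop :=
  exists r : 'I_2, T1 i r = 1 /\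
    forall l : 'I_2, l != r -> T1 i l = 1 ->
      forall n, 1 <= n -> gamma1 T1 T2 l n <= gamma1 T1 T2 r n.

Definition dominating_type (T1 T2 : mat2) : Prop :=
  [/\ has_dominate_item1 T1 T2 idx1, has_dominate_item1 T1 T2 idx2,
      has_dominate_item2 T1 T2 idx1 & has_dominate_item2 T1 T2 idx2].

Definition oscillating_type (T1 T2 : mat2) : Prop :=
  exists m1 m2 : nat -> nat,
    (forall n, m1 n < m1 n.+1) /\ (forall n, m2 n < m2 n.+1) /\
    (forall n, 0 < m1 n /\ 0 < m2 n) /\
    (forall a b, m1 a <> m2 b) /\
    (forall p, 0 < p -> (exists a, m1 a = p) \/ (exists b, m2 b = p)) /\
    (forall a, gamma1 T1 T2 idx2 (m1 a) <= gamma1 T1 T2 idx1 (m1 a)) /\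
    (forall b, gamma1 T1 T2 idx1 (m2 b) < gamma1 T1 T2 idx2 (m2 b)).

(* Main.v *)
(** Write [a, b] for the two sequences [gamma1] and [c, d] for the two sequences
    [gamma2], indexed so that [|alpha_a| < |alpha_b|] (equality is the equal
    growth type).  If each row of index [b] majorizes the row of index [a], then
    [a <= b] and [c <= d] persist forever, and ordered sequences give dominate
    items.  Otherwise one of the two matrices has the rows [01 / 10], which
    leaves four systems.  Since [c] and [d] depend only on the previous [a] and
    [b], each becomes a second-order rational recurrence for the ratio
    [x = b / a]:
    - [x_{n+2} = (1 + 1 / x_n) / x_{n+1}] stays [>= 1], so items are ordered;
    - [x_{n+2} = (1 + x_n) / x_{n+1}] and its companion for [y = 1 / x],
      [y_{n+2} = (1 + y_n) / (1 + y_{n+1})], eventually alternate around [1];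
    - [x_{n+2} = (1 + x_{n+1}) / (1 + x_n)] cannot stay on one side of [1]. *)
Require Import Defs.
From mathcomp Require Import all_boot all_order all_algebra zify.

(** * Infinite recurrence and oscillation *)

Definition recurrent (P : pred nat) : Prop := forall N, exists n, N < n /\ P n.

(** Both comparisons are strict, which makes the notion symmetric: the smaller [alpha_card] may
    belong to either index. *)
Definition oscillates (u v : nat -> nat) : Prop :=
  recurrent (fun n => u n < v n) /\ recurrent (fun n => v n < u n).

Lemma oscillates_sym (u v : nat -> nat) : oscillates u v -> oscillates v u.
Proof. by case. Qed.

Lemma recurrent_enum (P : pred nat) : recurrent P ->
  exists m : nat -> nat, [/\ forall n, m n < m n.+1, forall n, 0 < m n,
    forall n, P (m n) & forall p, 0 < p -> P p -> exists a, m a = p].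
Proof.
move=> recP.
have ex N : exists n, (N < n) && P n.
  by have [n [ltNn Pn]] := recP N; exists n; rewrite ltNn.
pose next N := ex_minn (ex N).
have nextP N : N < next N /\ P (next N).
  by rewrite /next; case: ex_minnP => n /andP[].
have next_min N p : N < p -> P p -> next N <= p.
  by rewrite /next; case: ex_minnP => n _ min_n ltNp Pp; apply: min_n; rewrite ltNp.
pose m n := iter n.+1 next 0.
have m_incr n : m n < m n.+1 by case: (nextP (m n)).
have m_ge n : n < m n.
  by elim: n => [|n IHn]; [case: (nextP 0) | apply: leq_ltn_trans IHn (m_incr n)].
exists m; split=> // [n|n|p p_gt0 Pp].
- exact: leq_ltn_trans (leq0n n) (m_ge n).
- by case: (nextP (iter n next 0)).
(* The first [m k] reaching [p] is the least point of [P] beyond a number below [p], so it cannot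
   overshoot [p]. *)
have exk : exists k, p <= m k by exists p; apply: ltnW.
case: (ex_minnP exk) => k le_pmk min_k; exists k; apply/eqP.
rewrite eqn_leq le_pmk andbT; apply: next_min => //.
case: k min_k {le_pmk} => [//|k] min_k; rewrite ltnNge; apply/negP => /min_k.
by rewrite ltnn.
Qed.

Lemma alternation_oscillates (u v : nat -> nat) (n0 : nat) :
  u n0 < v n0 -> v n0.+1 < u n0.+1 ->
  (forall n, u n < v n -> v n.+1 < u n.+1 ->
     u n.+2 < v n.+2 /\ v n.+3 < u n.+3) ->
  oscillates u v.
Proof.
move=> lt0 gt1 step.
have alt k : u (n0 + k.*2) < v (n0 + k.*2) /\ v (n0 + k.*2).+1 < u (n0 + k.*2).+1.
  by elim: k => [|k [IH0 IH1]]; rewrite ?addn0 // doubleS !addnS; apply: step.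
split=> N; have [lt gt] := alt N.+1.
  by exists (n0 + N.+1.*2); split=> //; lia.
by exists (n0 + N.+1.*2).+1; split=> //; lia.
Qed.

(** * The four recurrences for the ratio *)

Lemma ratio_inv_succ_oscillates (a b : nat -> nat) :
  a 0 = 1 -> b 0 = 1 -> a 1 = 1 -> b 1 = 2 ->
  (forall n, a n.+2 = b n.+1 * a n) ->
  (forall n, b n.+2 = a n.+1 * (a n + b n)) ->
  oscillates a b.
Proof.
move=> a0 b0 a1 b1 recA recB.
have [a2 b2] : a 2 = 2 /\ b 2 = 2 by rewrite (recA 0) (recB 0) a0 b0 a1 b1.
have [a3 b3] : a 3 = 2 /\ b 3 = 6 by rewrite (recA 1) (recB 1) a1 b1 a2 b2.
have [a4 b4] : a 4 = 12 /\ b 4 = 8 by rewrite (recA 2) (recB 2) a2 b2 a3 b3.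
(* The ratio [x = b / a] starts 1, 2, 1, 3, 2/3; index 3 is the first with a strict drop from above
   1 to below 1. *)
apply: (@alternation_oscillates _ _ 3); rewrite ?a3 ?b3 ?a4 ?b4 // => n lt0 gt1.
(* [x_{n+3} < 1] amounts to [x_{n+1} + x_{n+1}^2 < 1 + x_n], which sums [x_{n+1} <= 1] ([le1]) and
   [x_{n+1}^2 < x_n] ([lt01]). *)
have le1 : b n.+1 * a n <= a n.+1 * a n by rewrite leq_mul2r ltnW ?orbT.
have pos : 0 < a n.+1 * b n by rewrite muln_gt0 (leq_ltn_trans _ gt1) ?(leq_ltn_trans _ lt0).
have lt01 : b n.+1 * b n.+1 * a n < a n.+1 * a n.+1 * b n by rewrite !ltn_mul.
split; first by rewrite recA recB; lia.
rewrite (recA n.+1) (recB n.+1) recA recB.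
by have := leq_mul le1 (leqnn (a n.+1)); lia.
Qed.

(** For [y = a / b], [y_{n+2}] lies on the same side of 1 as [y_n] does of [y_{n+1}]. So
    [y_n < 1 < y_{n+1}] gives [y_{n+2} < 1], and then [y_{n+1} > y_{n+2}] gives [y_{n+3} > 1]. *)
Lemma ratio_quot_oscillates (a b : nat -> nat) :
  a 0 = 1 -> b 0 = 1 -> a 1 = 1 -> b 1 = 2 ->
  (forall n, 0 < b n) ->
  (forall n, a n.+2 = b n.+1 * (a n + b n)) ->
  (forall n, b n.+2 = (a n.+1 + b n.+1) * b n) ->
  oscillates a b.
Proof.
move=> a0 b0 a1 b1 b_gt0 recA recB.
have [a2 b2] : a 2 = 4 /\ b 2 = 3 by rewrite (recA 0) (recB 0) a0 b0 a1 b1.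
apply: (@alternation_oscillates _ _ 1); rewrite ?a1 ?b1 ?a2 ?b2 // => n lt0 gt1.
have lt2 : a n.+2 < b n.+2.
  by rewrite recA recB; have := b_gt0 n.+1; nia.
split=> //; rewrite (recA n.+1) (recB n.+1); have := b_gt0 n.+2; nia.
Qed.

Lemma ratio_quot_rev_oscillates (a b : nat -> nat) :
  a 1 <> b 1 ->
  (forall n, 0 < a n) -> (forall n, 0 < b n) ->
  (forall n, a n.+2 = a n.+1 * (a n + b n)) ->
  (forall n, b n.+2 = (a n.+1 + b n.+1) * a n) ->
  oscillates a b.
Proof.
move=> neq1 a_gt0 b_gt0 recA recB.
(* Two consecutive ratios equal to 1 force the preceding one to be 1, and so on back to [x_1],
   against [neq1]. *)
have neq n : ~ (a n = b n /\ a n.+1 = b n.+1).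
  elim: n => [[] //|n IHn [eq1 eq2]]; apply: IHn; split=> //.
  by move: eq2; rewrite recA recB -eq1; have := a_gt0 n.+1; nia.
(* With [x = b / a]: [x_{n+2} >= 1] iff [x_{n+1} >= x_n], while
   [x_{n+2} >= x_{n+1}] iff [x_n x_{n+1} <= 1]. *)
have cmp2 n : (a n.+2 <= b n.+2) = (a n.+1 * b n <= b n.+1 * a n).
  by rewrite recA recB mulnDr mulnDl leq_add2l.
have cmp2' n : (b n.+2 <= a n.+2) = (b n.+1 * a n <= a n.+1 * b n).
  by rewrite recA recB mulnDr mulnDl leq_add2l.
have cmp3 n : (a n.+3 <= b n.+3) = (b n * b n.+1 <= a n * a n.+1).
  by rewrite cmp2 recA recB -[RHS](leq_pmul2l (a_gt0 n.+1)); apply/idP/idP; lia.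
have cmp3' n : (b n.+3 <= a n.+3) = (a n * a n.+1 <= b n * b n.+1).
  by rewrite cmp2' recA recB -[RHS](leq_pmul2l (a_gt0 n.+1)); apply/idP/idP; lia.
(* The last inequality reads [x_n x_{n+1} <= 1]; with [x_n, x_{n+1} >= 1] both ratios are 1, which
   [neq] forbids. So no four consecutive ratios stay on one side of 1. *)
have win_le n : ~ [/\ a n <= b n, a n.+1 <= b n.+1, a n.+2 <= b n.+2 & a n.+3 <= b n.+3].
  case=> le0 le1 _; rewrite cmp3 => le3; apply: (neq n).
  by have := a_gt0 n; have := a_gt0 n.+1; split; nia.
have win_ge n : ~ [/\ b n <= a n, b n.+1 <= a n.+1, b n.+2 <= a n.+2 & b n.+3 <= a n.+3].
  case=> le0 le1 _; rewrite cmp3' => le3; apply: (neq n).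
  by have := b_gt0 n; have := b_gt0 n.+1; split; nia.
split=> N.
- case: (leqP (b N.+1) (a N.+1)) => [h1|]; last by exists N.+1.
  case: (leqP (b N.+2) (a N.+2)) => [h2|]; last by exists N.+2; split=> //; lia.
  case: (leqP (b N.+3) (a N.+3)) => [h3|]; last by exists N.+3; split=> //; lia.
  case: (leqP (b N.+4) (a N.+4)) => [h4|]; last by exists N.+4; split=> //; lia.
  by case: (win_ge N.+1).
- case: (leqP (a N.+1) (b N.+1)) => [h1|]; last by exists N.+1.
  case: (leqP (a N.+2) (b N.+2)) => [h2|]; last by exists N.+2; split=> //; lia.
  case: (leqP (a N.+3) (b N.+3)) => [h3|]; last by exists N.+3; split=> //; lia.
  case: (leqP (a N.+4) (b N.+4)) => [h4|]; last by exists N.+4; split=> //; lia.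
  by case: (win_le N.+1).
Qed.

Lemma ratio_inv_quot_ge1 (a b : nat -> nat) :
  a 0 = 1 -> b 0 = 1 -> a 1 = 1 -> b 1 = 2 ->
  (forall n, a n.+2 = b n.+1 * b n) ->
  (forall n, b n.+2 = a n.+1 * (a n + b n)) ->
  forall n, a n <= b n.
Proof.
move=> a0 b0 a1 b1 recA recB.
(* Eliminating [x_{n+2}] gives [x_{n+3} = x_n (1 + x_{n+1}) / (1 + x_n)], which
   is [>= 1] iff [x_n x_{n+1} >= 1]. *)
have step n : a n <= b n -> a n.+1 <= b n.+1 -> a n.+3 <= b n.+3.
  move=> le0 le1; rewrite (recA n.+1) (recB n.+1) recA recB.
  have le01 := leq_mul le0 le1.
  have : (a n.+1 * (a n + b n) <= b n * (a n.+1 + b n.+1)) by lia.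
  by move/(leq_mul (leqnn (b n.+1))); lia.
(* [step] skips the bound at [n.+2], so the induction carries three consecutive bounds. *)
suff: forall n, [/\ a n <= b n, a n.+1 <= b n.+1 & a n.+2 <= b n.+2].
  by move=> le3 n; case: (le3 n).
elim=> [|n [le0 le1 le2]]; last by split=> //; apply: step.
by rewrite (recA 0) (recB 0) a0 b0 a1 b1.
Qed.

(** * From ordered sequences to dominate items *)

Definition ordered (f : 'I_2 -> nat -> nat) : Prop :=
  exists r, forall l n, 0 < n -> f l n <= f r n.

(** If the maximal index lies outside [P], then [P] is a single point, as ['I_2] has only two. *)
Lemma ordered_subset (f : 'I_2 -> nat -> nat) (P : pred 'I_2) :
  ordered f -> (exists j, P j) ->
  exists2 r, P r & forall l n, P l -> 0 < n -> f l n <= f r n.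
Proof.
case=> r f_le [j Pj]; case Pr: (P r).
  by exists r => // l n _; apply: f_le.
exists j => // l n Pl _; suff -> : l = j by [].
have neq k : P k -> (k : nat) <> r by move=> Pk /val_inj eq_kr; rewrite eq_kr Pr in Pk.
apply: val_inj => /=; have := neq _ Pl; have := neq _ Pj.
by have := ltn_ord l; have := ltn_ord j; have := ltn_ord r; lia.
Qed.

Lemma zero_one_row (T : mat2) (i : 'I_2) : zero_one T -> no_zero_row T ->
  exists j, T i j == 1.
Proof.
by move=> T01 Tnz; have [j] := Tnz i; exists j; have := T01 i j; lia.
Qed.

(** The allowed pairs [(j, k)] form a rectangle, so maximizing each factor separately maximizes the
    product. *)
Lemma ordered_dominating (T1 T2 : mat2) :
  zero_one T1 -> zero_one T2 -> no_zero_row T1 -> no_zero_row T2 ->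
  ordered (gamma1 T1 T2) -> ordered (gamma2 T1 T2) -> dominating_type T1 T2.
Proof.
move=> z1 z2 nz1 nz2 ord1 ord2.
have dom2 i : has_dominate_item2 T1 T2 i.
  have [r /eqP Tr r_max] := ordered_subset _ _ ord1 (zero_one_row _ i z1 nz1).
  by exists r; split=> // l _ /eqP Tl n; apply: r_max.
have dom1 i : has_dominate_item1 T1 T2 i.
  have [r /eqP Tr r_max] := ordered_subset _ _ ord1 (zero_one_row _ i z1 nz1).
  have [s /eqP Ts s_max] := ordered_subset _ _ ord2 (zero_one_row _ i z2 nz2).
  exists (r, s); rewrite Tr Ts; split=> // l _ /eqP; rewrite muln_eq1 => /andP[Tl Tl'] n n_gt0.
  by apply: leq_mul; [apply: r_max | apply: s_max].
by split.
Qed.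

Lemma oscillates_oscillating (T1 T2 : mat2) :
  oscillates (gamma1 T1 T2 idx1) (gamma1 T1 T2 idx2) -> oscillating_type T1 T2.
Proof.
case=> rec_lt rec_gt.
(* Ties are assigned to [m1], which makes the two enumerated sets complementary. *)
have rec_ge : recurrent (fun n => gamma1 T1 T2 idx2 n <= gamma1 T1 T2 idx1 n).
  by move=> N; have [n [ltNn /ltnW le]] := rec_gt N; exists n.
have [m1 [incr1 pos1 in1 onto1]] := recurrent_enum _ rec_ge.
have [m2 [incr2 pos2 in2 onto2]] := recurrent_enum _ rec_lt.
exists m1, m2; do ![split=> //].
  by move=> a b eq_m; have := in2 b; rewrite -eq_m ltnNge in1.
move=> p p_gt0; case: (leqP (gamma1 T1 T2 idx2 p) (gamma1 T1 T2 idx1 p)) => cmp.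
  by left; apply: onto1.
by right; apply: onto2.
Qed.

(** * The recurrence written for an arbitrary labelling of the two indices *)

Lemma ord2_cases (i j k : 'I_2) : i != j -> k = i \/ k = j.
Proof.
case: (eqVneq k i) => [|neq_ki neq_ij]; [by left | right; apply: val_inj => /=].
move: neq_ij neq_ki; rewrite -!val_eqE /=.
by have := ltn_ord i; have := ltn_ord j; have := ltn_ord k; lia.
Qed.

Lemma sum_ord2 (i j : 'I_2) (F : 'I_2 -> nat) : i != j -> \sum_(k < 2) F k = F i + F j.
Proof.
move=> neq_ij; rewrite (bigD1 i) //= (bigD1 j) 1?eq_sym //= big1 ?addn0 // => k /andP[].
move: neq_ij; rewrite -!val_eqE /=.
by have := ltn_ord i; have := ltn_ord j; have := ltn_ord k; lia.
Qed.

Section System.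

Variables T1 T2 : mat2.
Local Notation g1 := (gamma1 T1 T2).
Local Notation g2 := (gamma2 T1 T2).

Lemma gamma2S (i j k : 'I_2) (n : nat) : i != j ->
  g2 k n.+1 = T1 k i * g1 i n + T1 k j * g1 j n.
Proof. by move=> neq_ij; rewrite /gamma2 /= (sum_ord2 _ _ _ neq_ij). Qed.

Lemma gamma1S (i j k : 'I_2) (n : nat) : i != j ->
  g1 k n.+1 = (T1 k i * g1 i n + T1 k j * g1 j n) * (T2 k i * g2 i n + T2 k j * g2 j n).
Proof.
move=> neq_ij; rewrite /gamma1 /gamma2 /= !(sum_ord2 _ _ _ neq_ij).
rewrite mulnDl !mulnDr; lia.
Qed.

Lemma alpha_cardE (i j k : 'I_2) : zero_one T1 -> zero_one T2 -> i != j ->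
  alpha_card T1 T2 k = (T1 k i + T1 k j) * (T2 k i + T2 k j).
Proof.
move=> z1 z2 neq_ij; rewrite -!(sum_ord2 i j (fun l => _ k l) neq_ij) big_distrlr /=.
rewrite pair_big /= /alpha_card cardsE -sum1_card big_mkcond /=.
apply: eq_bigr => l _; rewrite unfold_in /=.
by have := z1 k l.1; have := z2 k l.2; case: (T1 k l.1) => [|[]] //; case: (T2 k l.2) => [|[]].
Qed.

Lemma gamma_gt0 : no_zero_row T1 -> no_zero_row T2 ->
  forall n k, 0 < g1 k n /\ 0 < g2 k n.
Proof.
move=> nz1 nz2.
have neq : idx1 != idx2 by [].
have row_gt0 T k (u : 'I_2 -> nat) : no_zero_row T -> (forall l, 0 < u l) ->
    0 < T k idx1 * u idx1 + T k idx2 * u idx2.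
  move=> nzT u_gt0; have [l Tkl] := nzT k.
  rewrite -(sum_ord2 idx1 idx2 (fun l => T k l * u l) neq) (bigD1 l) //=.
  by rewrite addn_gt0 muln_gt0 u_gt0 lt0n Tkl.
elim=> [//|n IHn] k; rewrite (gamma1S _ _ _ _ neq) (gamma2S _ _ _ _ neq) muln_gt0.
by rewrite !row_gt0 // => l; case: (IHn l).
Qed.

(** Abel summation: for [u <= v], [p * u + q * v = (p + q) * u + q * (v - u)] is monotone in the row
    total [p + q] and the last entry [q], the two quantities compared here. *)
Lemma majorized_ordered (i j : 'I_2) : i != j ->
  T1 i j <= T1 j j -> T1 i i + T1 i j <= T1 j i + T1 j j ->
  T2 i j <= T2 j j -> T2 i i + T2 i j <= T2 j i + T2 j j ->
  ordered g1 /\ ordered g2.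
Proof.
move=> neq_ij maj1 maj1' maj2 maj2'.
have row_le (p q r s u v : nat) : q <= s -> p + q <= r + s -> u <= v ->
    p * u + q * v <= r * u + s * v by nia.
have le_ij n : g1 i n <= g1 j n /\ g2 i n <= g2 j n.
  elim: n => [//|n [IH1 IH2]].
  rewrite !(gamma1S _ _ _ _ neq_ij) !(gamma2S _ _ _ _ neq_ij).
  by split; [apply: leq_mul|]; apply: row_le.
by split; exists j => l n _; case: (ord2_cases _ _ l neq_ij) => ->; case: (le_ij n).
Qed.

Lemma smaller_alpha_cases (i j : 'I_2) :
  zero_one T1 -> zero_one T2 -> no_zero_row T1 -> no_zero_row T2 ->
  i != j -> alpha_card T1 T2 i < alpha_card T1 T2 j ->
  (ordered g1 /\ ordered g2) \/ oscillates (g1 i) (g1 j).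
Proof.
move=> z1 z2 nz1 nz2 neq_ij.
rewrite !(alpha_cardE _ _ _ z1 z2 neq_ij) => lt_alpha.
have pos := gamma_gt0 nz1 nz2.
have row_gt0 T k : no_zero_row T -> 0 < T k i + T k j.
  move=> nzT; have [l Tkl] := nzT k.
  by rewrite -(sum_ord2 i j (T k) neq_ij) (bigD1 l) //= addn_gt0 lt0n Tkl.
(* Row sums are 1 or 2, so the strict inequality makes those of row [i] at most those of row [j],
   strictly in one matrix. Majorization then fails only if the other matrix has rows [01 / 10]; the
   strict one has row [j] full and either singleton as row [i]. *)
have [maj | exc] :
    [/\ T1 i j <= T1 j j, T1 i i + T1 i j <= T1 j i + T1 j j,
        T2 i j <= T2 j j & T2 i i + T2 i j <= T2 j i + T2 j j]
  \/ [\/ [/\ T1 i i = 0, T1 i j = 1, T1 j i = 1 & T1 j j = 0] /\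
          [/\ T2 i i = 1, T2 i j = 0, T2 j i = 1 & T2 j j = 1],
         [/\ T1 i i = 0, T1 i j = 1, T1 j i = 1 & T1 j j = 0] /\
          [/\ T2 i i = 0, T2 i j = 1, T2 j i = 1 & T2 j j = 1],
         [/\ T1 i i = 0, T1 i j = 1, T1 j i = 1 & T1 j j = 1] /\
          [/\ T2 i i = 0, T2 i j = 1, T2 j i = 1 & T2 j j = 0] |
         [/\ T1 i i = 1, T1 i j = 0, T1 j i = 1 & T1 j j = 1] /\
          [/\ T2 i i = 0, T2 i j = 1, T2 j i = 1 & T2 j j = 0]].
- move: (z1 i i) (z1 i j) (z1 j i) (z1 j j) (z2 i i) (z2 i j) (z2 j i) (z2 j j).
  move: lt_alpha (row_gt0 T1 i nz1) (row_gt0 T1 j nz1) (row_gt0 T2 i nz2) (row_gt0 T2 j nz2).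
  case: (T1 i i) => [|[|//]]; case: (T1 i j) => [|[|//]];
  case: (T1 j i) => [|[|//]]; case: (T1 j j) => [|[|//]] //;
  case: (T2 i i) => [|[|//]]; case: (T2 i j) => [|[|//]] //;
  case: (T2 j i) => [|[|//]]; case: (T2 j j) => [|[|//]] // *;
  by [left | right; constructor 1 | right; constructor 2
     | right; constructor 3 | right; constructor 4].
- by left; case: maj; apply: majorized_ordered.
have S1 k n := gamma1S i j k n neq_ij.
have S2 k n := gamma2S i j k n neq_ij.
have init k : g1 k 0 = 1 /\ g2 k 0 = 1 by [].
have [[i1 i2] [j1 j2]] := (init i, init j).
have [gt1 gt2] : (forall k n, 0 < g1 k n) /\ (forall k n, 0 < g2 k n).
  by split=> k n; case: (pos n k).
case: exc => [] [[p q r s] [p' q' r' s']].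
- left.
  have le_ij : forall n, g1 i n <= g1 j n.
    by apply: ratio_inv_quot_ge1 => // [||n|n]; rewrite S1 ?S2 ?p ?q ?r ?s ?p' ?q' ?r' ?s' ?i1 ?i2 ?j1 ?j2; lia.
  (* [T1] swaps the indices, so [gamma2] at [n.+1] is [gamma1] at [n] with [i] and [j] exchanged:
     its largest index is [i]. *)
  split; [exists j => l n _ | exists i => l [//|n] _];
    case: (ord2_cases _ _ l neq_ij) => -> //.
  by rewrite !S2 p q r s; have := le_ij n; lia.
- right; apply: ratio_inv_succ_oscillates => // [||n|n];
  by rewrite S1 ?S2 ?p ?q ?r ?s ?p' ?q' ?r' ?s' ?i1 ?i2 ?j1 ?j2; lia.
- right; apply: ratio_quot_oscillates => // [||n|n];
  by rewrite S1 ?S2 ?p ?q ?r ?s ?p' ?q' ?r' ?s' ?i1 ?i2 ?j1 ?j2; lia.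
- right; apply: ratio_quot_rev_oscillates => // [|n|n];
  by rewrite !S1 ?S2 ?p ?q ?r ?s ?p' ?q' ?r' ?s' ?i1 ?i2 ?j1 ?j2; lia.
Qed.

End System.

Theorem theorem5 (T1 T2 : 'M[nat]_2) :
  zero_one T1 -> zero_one T2 -> no_zero_row T1 -> no_zero_row T2 ->
  zero_entropy_type T1 T2 \/ equal_growth_type T1 T2 \/
  dominating_type T1 T2 \/ oscillating_type T1 T2.
Proof.
move=> z1 z2 nz1 nz2; right.
have concl : (ordered (gamma1 T1 T2) /\ ordered (gamma2 T1 T2)) \/
    oscillates (gamma1 T1 T2 idx1) (gamma1 T1 T2 idx2) ->
    dominating_type T1 T2 \/ oscillating_type T1 T2.
  case=> [[ord1 ord2]|osc]; first by left; apply: ordered_dominating.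
  by right; apply: oscillates_oscillating.
case: (ltngtP (alpha_card T1 T2 idx1) (alpha_card T1 T2 idx2)) => cmp; last by left.
  by right; apply: concl; apply: smaller_alpha_cases.
right; apply: concl.
case: (smaller_alpha_cases T1 T2 idx2 idx1 z1 z2 nz1 nz2 isT cmp); first by left.
by move/oscillates_sym; right.
Qed.
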